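(* For every $k\in\mathbb{N}$, $\operatorname{coasdim}(X_{\omega+k})=\omega+k$, where $X_{\omega+k}=\mathrm{as}\bigsqcup_{i=1}^{\infty}X_{\omega+k}^{(i)}$ and $X_{\omega+k}^{(i)}=\{(x_1,\ldots,x_i)\in\mathbb{R}^i : |\{j : x_j\notin 2^i\mathbb{Z}\}|\leq k\}$.
   Context: $\mathbb{N}=\{1,2,3,\ldots\}$; $\omega$ is the smallest infinite ordinal. Families of subsets. Let $(X,d)$ be a metric space. For $r>0$, a family $\mathcal{U}$ of subsets of $X$ is $r$-disjoint if $d(U,V)=\inf\{d(x,y):x\in U,y\in V\}>r$ for all $U\neq V$ in $\mathcal{U}$. It is uniformly bounded if $\sup\{\operatorname{diam}U:U\in\mathcal{U}\}<\infty$. $\bigcup\mathcal{U}$ denotes the union of the members of $\mathcal{U}$. Complementary-finite asymptotic dimension. Every ordinal $\gamma$ is written $\gamma=\lambda(\gamma)+n(\gamma)$ with $\lambda(\gamma)$ a limit ordinal or $0$ and $n(\gamma)\in\mathbb{N}\cup\{0\}$. Define $\operatorname{coasdim}$ inductively: $\operatorname{coasdim}(X)=-1$ iff $X=\emptyset$; $\operatorname{coasdim}(X)\leq\gamma$ iff for every $r>0$ there exist $r$-disjoint uniformly bounded families $\mathcal{U}_0,\ldots,\mathcal{U}_{n(\gamma)}$ of subsets of $X$ such that $\operatorname{coasdim}(X\setminus\bigcup(\bigcup_{i=0}^{n(\gamma)}\mathcal{U}_i))<\lambda(\gamma)$; $\operatorname{coasdim}(X)=\gamma$ iff $\operatorname{coasdim}(X)\leq\gamma$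 and $\operatorname{coasdim}(X)\leq\beta$ is not true for every $\beta<\gamma$; $\operatorname{coasdim}(X)=\infty$ iff $\operatorname{coasdim}(X)\leq\gamma$ holds for no ordinal $\gamma$. Asymptotic union. For a sequence $\{Z_i\}_{i=1}^\infty$ of subspaces of a metric space $(Z,d_Z)$, the asymptotic union $\mathrm{as}\bigsqcup_{i=1}^{\infty}Z_i$ is the disjoint union of the $Z_i$ with the metric given, for $x$ in the $l$-th summand $Z_l$ and $y$ in the $k$-th summand $Z_k$ with $l\leq k$, by $d(x,y)=d_Z(x,y)+c$, where $c=0$ if $l=k$ and $c=l+(l+1)+\cdots+(k-1)$ if $l<k$. Here each $X_{\omega+k}^{(i)}\subset\mathbb{R}^i$ is regarded as a subspace of $(\bigoplus\mathbb{R},d_{\max})$, the space of finitely supported real sequences with the max metric, where $\mathbb{R}^i$ is identified with the sequences vanishing after the $i$-th coordinate. *)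

(* Defs.v *)
From HB Require Import structures.
From mathcomp Require Import all_boot all_order all_algebra finmap.
From mathcomp Require Import all_classical all_reals all_analysis.

Set Implicit Arguments.
Unset Strict Implicit.
Unset Printing Implicit Defensive.

From mathcomp Require Import zify.

Import Order.TTheory GRing.Theory Num.Theory.

Local Open Scope classical_set_scope.
Local Open Scope ring_scope.

(** * Ordinals

    A well-founded tree [Osup f] denotes the least ordinal strictly greater
    than all the [f i].  Every tree denotes an ordinal; distinct trees may
    denote the same one, so that equality of ordinals is [ord_eq], not [=]. *)

Inductive Ord : Type := Osup (I : Type) (f : I -> Ord).

(* sup (f i + 1) <= sup (g j + 1)  iff  every f i is <= some g j *)
Fixpoint ord_le (a b : Ord) : Prop :=
  let: Osup A f := a in let: Osup B g := b in
  forall i : A, exists j : B, ord_le (f i) (g j).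

Definition ord_lt (a b : Ord) : Prop :=
  let: Osup B g := b in exists j : B, ord_le a (g j).

Definition ord_eq (a b : Ord) : Prop := ord_le a b /\ ord_le b a.

Definition Ozero : Ord := Osup (fun i : void => match i with end).

Definition Osucc (a : Ord) : Ord := Osup (fun _ : unit => a).

Definition Oaddn (a : Ord) (n : nat) : Ord := iter n Osucc a.

Definition Oomega : Ord := Osup (Oaddn Ozero).

Definition limit_or_zero (a : Ord) : Prop := ~ exists b, ord_eq a (Osucc b).

Lemma ord_le_refl a : ord_le a a.
Proof. by elim: a => A f IH i; exists i; exact: IH. Qed.

Lemma ord_le_trans b a c : ord_le a b -> ord_le b c -> ord_le a c.
Proof.
elim: a b c => A f IH [B g] [C h] ab bc i.
by have [j /IH fg] := ab i; have [l /fg ?] := bc j; exists l.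
Qed.

Lemma ord_ltW a b : ord_lt a b -> ord_le a b.
Proof.
elim: b a => B g IH [A f] [j] + i => aj; exists j.
apply: IH; case: (g j) aj => C h /(_ i) [l fl]; by exists l.
Qed.

Lemma ord_leS a b : ord_le a b -> ord_le (Osucc a) (Osucc b).
Proof. by move=> ab /= _; exists tt. Qed.

Lemma ord_lt_wf : well_founded ord_lt.
Proof.
suff: forall a b, ord_le b a -> Acc ord_lt b by move=> + a; apply; exact: ord_le_refl.
elim=> A f IH [B g] ba; constructor => c [j cj].
by have [i gi] := ba j; apply: (IH i); exact: ord_le_trans gi.
Qed.

(* every ordinal is lambda + n *)
Lemma ord_decomposition a :
  exists lambda n, limit_or_zero lambda /\ ord_eq a (Oaddn lambda n).
Proof.
elim/(well_founded_ind ord_lt_wf): a => a IH.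
have [al|] := pselect (limit_or_zero a).
  by exists a, 0%N; split=> //; split; exact: ord_le_refl.
move=> /contrapT[b [ab ba]].
have [|lambda [n [ll [bn nb]]]] := IH b.
  by case: a ba {ab IH} => A f ba; exact: (ba tt).
exists lambda, n.+1; split=> //; split.
  exact: ord_le_trans ab (ord_leS bn).
exact: ord_le_trans (ord_leS nb) ba.
Qed.

(** * Families of subsets of a metric space *)

Section families.
Context {R : realType} {X : metricType R}.

Definition setdist (U V : set X) : \bar R :=
  ereal_inf [set (mdist x y)%:E | x in U & y in V].

(* diam of the empty set is -oo here; this does not affect boundedness *)
Definition diam (U : set X) : \bar R :=
  ereal_sup [set (mdist x y)%:E | x in U & y in U].

Definition r_disjoint (r : R) (F : set (set X)) : Prop :=
  forall U V, F U -> F V -> U <> V -> (r%:E < setdist U V)%E.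

Definition uniformly_bounded (F : set (set X)) : Prop :=
  (ereal_sup [set diam U | U in F] < +oo)%E.

End families.

(** * Complementary-finite asymptotic dimension

    A subspace of [X] is a set [A : set X] with the restricted distance. *)

(* [coasdim_le A gamma] is coasdim(A) <= gamma.  Here lambda = lambda(gamma)
   and n = n(gamma).  The last disjunction is coasdim(B) < lambda: either
   coasdim(B) = -1, that is B is empty, or coasdim(B) <= beta for some ordinal
   beta < lambda. *)
Inductive coasdim_le {R : realType} {X : metricType R} :
    set X -> Ord -> Prop :=
| CoasdimLe (A : set X) (gamma lambda : Ord) (n : nat) :
    limit_or_zero lambda -> ord_eq gamma (Oaddn lambda n) ->
    (forall r : R, 0 < r -> exists F : 'I_n.+1 -> set (set X),
       [/\ forall i U, F i U -> U `<=` A,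
           forall i, r_disjoint r (F i),
           forall i, uniformly_bounded (F i) &
           let B := A `\` \bigcup_i \bigcup_(U in F i) U in
           B = set0 \/ exists2 beta, ord_lt beta lambda & coasdim_le B beta]) ->
    coasdim_le A gamma.

Inductive dimension := Dminus1 | Dord of Ord | Dinfty.

Definition coasdim_is {R : realType} {X : metricType R} (A : set X)
    (v : dimension) : Prop :=
  match v with
  | Dminus1 => A = set0
  | Dord gamma => [/\ A <> set0, coasdim_le A gamma &
                      forall beta, ord_lt beta gamma -> ~ coasdim_le A beta]
  | Dinfty => forall gamma, ~ coasdim_le A gamma
  end.

(* the condition coasdim(B) < lambda of [coasdim_le] in terms of the value *)
Lemma coasdim_ltP {R : realType} {X : metricType R} (B : set X) (lambda : Ord) :
  (B = set0 \/ exists2 beta, ord_lt beta lambda & coasdim_le B beta) <->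
  (coasdim_is B Dminus1 \/
   exists2 beta, ord_lt beta lambda & coasdim_is B (Dord beta)).
Proof.
split=> [[->|[beta]]|[->|[beta bl []]]]; [by left| |by left|by right; exists beta].
elim/(well_founded_ind ord_lt_wf): beta => beta IH bl Bb.
have [->|B0] := pselect (B = set0); first by left.
have [[c cb Bc]|noc] :=
  pselect (exists2 c, ord_lt c beta & coasdim_le B c); last first.
  by right; exists beta => //; split=> // c cb Bc; apply: noc; exists c.
apply: (IH c cb) => //; case: lambda beta {IH Bb} bl cb => [L h] [A f] [l bl] [i cf].
exists l; apply: ord_le_trans bl; apply: ord_ltW; by exists i.
Qed.

(** * Asymptotic unions *)

Section as_union.
Context {R : realType} {T : metricType R}.

(* Pairs (i, x) with i >= 1 and x in Z_i; the value Z 0 is not used. *)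
Definition as_union (Z : nat -> set T) : Type :=
  {p : nat * T | (0 < p.1)%N && (p.2 \in Z p.1)}.

Variable Z : nat -> set T.
Implicit Types p q : as_union Z.

HB.instance Definition _ := Choice.on (as_union Z).

Definition as_dist p q : R :=
  let: (l, x) := val p in let: (k, y) := val q in
  mdist x y + (\sum_(minn l k <= j < maxn l k) j)%N%:R.

Let as_distxx p : as_dist p p = 0.
Proof.
by rewrite /as_dist; case: (val p) => l x; rewrite minnn maxnn big_geq// mdistxx addr0.
Qed.

Let as_dist_positivity p q : as_dist p q = 0 -> p = q.
Proof.
move=> pq0; apply: val_inj; move: pq0; rewrite /as_dist.
case: p q => [[l x]/= /andP[/= l0 _]] [[k y]/= /andP[/= k0 _]].
move/eqP; rewrite paddr_eq0 ?mdist_ge0// pnatr_eq0 => /andP[/eqP xy0 s0].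
suff -> : l = k by rewrite (mdist_positivity _ _ xy0).
apply/eqP; case: (ltngtP l k) s0 => // lk.
- by rewrite big_ltn// addn_eq0 gtn_eqF.
- by rewrite big_ltn// addn_eq0 gtn_eqF.
Qed.

Let as_dist_sym p q : as_dist p q = as_dist q p.
Proof.
rewrite /as_dist; case: (val p) (val q) => [l x] [k y].
by rewrite metric_sym minnC maxnC.
Qed.

Let as_dist_triangle q p s : as_dist p s <= as_dist p q + as_dist q s.
Proof.
rewrite /as_dist; case: (val p) (val q) (val s) => [l x] [k y] [m z].
rewrite addrACA lerD ?metric_triangle// -natrD ler_nat.
have sumE a b : (\sum_(minn a b <= j < maxn a b) j)%N =
    (\sum_(0 <= j < maxn a b) j - \sum_(0 <= j < minn a b) j)%N.
  by rewrite (@big_cat_nat _ _ _ (minn a b) 0 (maxn a b))//= ?addKn// geq_min leq_maxl.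
have mono a b : (a <= b)%N ->
    (\sum_(0 <= j < a) j <= \sum_(0 <= j < b) j)%N.
  by move=> ab; rewrite (@big_cat_nat _ _ _ a 0 b)//= leq_addr.
rewrite !sumE.
have := mono l k; have := mono k l; have := mono l m; have := mono m l.
have := mono k m; have := mono m k.
by case: (leqP l k) => ?; case: (leqP l m) => ?; case: (leqP k m) => ?; lia.
Qed.

HB.instance Definition _ := isMetric.Build R (as_union Z)
  as_distxx as_dist_positivity as_dist_sym as_dist_triangle.

End as_union.

(** * Finitely supported real sequences with the max metric

    The coordinates are numbered from 0. *)

Section finseq.
Context {R : realType}.

Definition finseq : Type := {fsfun nat -> R with 0}.

HB.instance Definition _ := Choice.on finseq.

Implicit Types x y z : {fsfun nat -> R with 0}.

Definition dmax x y : R :=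
  \big[Order.max/0]_(j <- (finsupp x `|` finsupp y)%fset) `|x j - y j|.

Let dmax_ge0 x y : 0 <= dmax x y.
Proof. exact: bigmax_ge_id. Qed.

Lemma le_dmax x y j : `|x j - y j| <= dmax x y.
Proof.
have [jxy|] := boolP (j \in (finsupp x `|` finsupp y)%fset).
  exact: (@Order.TotalTheory.le_bigmax_seq _ _ _ _ 0 j xpredT (fun i => `|x i - y i|) jxy).
rewrite in_fsetU negb_or => /andP[jx jy].
by rewrite !fsfun_dflt// subrr normr0.
Qed.

Let dmaxxx x : dmax x x = 0.
Proof.
by apply/le_anti; rewrite dmax_ge0 andbT; apply: bigmax_le => // j _; rewrite subrr normr0.
Qed.

Let dmax_positivity x y : dmax x y = 0 -> x = y.
Proof.
move=> xy0; apply/fsfunP => j; apply/eqP.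
by rewrite -subr_eq0 -normr_le0; move: (le_dmax x y j); rewrite xy0.
Qed.

Let dmax_sym x y : dmax x y = dmax y x.
Proof. by rewrite /dmax fsetUC; apply: eq_bigr => j _; rewrite distrC. Qed.

Let dmax_triangle y x z : dmax x z <= dmax x y + dmax y z.
Proof.
apply: bigmax_le => [|j _]; first by rewrite addr_ge0.
by rewrite (le_trans (ler_distD (y j) _ _))// lerD ?le_dmax.
Qed.

HB.instance Definition _ := isMetric.Build R finseq
  dmaxxx dmax_positivity dmax_sym dmax_triangle.

End finseq.
Arguments finseq : clear implicits.

(** * The spaces X_{omega+k} *)

(* a Z *)
Definition multiples {R : realType} (a : R) : set R := range (fun z : int => a * z%:~R).

Definition Xpart (R : realType) (k i : nat) : set (finseq R) :=
  [set x : {fsfun nat -> R with 0} |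
    (forall j, (i <= j)%N -> x j = 0) /\
    (#|[pred j : 'I_i | x j \notin multiples (2 ^+ i : R)]| <= k)%N].

Arguments Xpart : clear implicits.

Definition Xomega (R : realType) (k : nat) : Type := as_union (Xpart R k).

HB.instance Definition _ (R : realType) (k : nat) := Metric.on (Xomega R k).

(* Main.v *)
Require Import Defs.
From mathcomp Require Import all_boot all_order all_algebra all_fingroup finmap.
From mathcomp Require Import all_classical all_reals all_analysis.
From mathcomp Require Import zify lra.

(** Fix [k >= 1] and write [L = 2 ^ i]: the [i]-th summand is the [k]-skeleton
    of the cubical grid [L Z] in dimension [i].

    Upper bound.  Given [r], choose a power of two [s] much larger than [r].
    For all [i] with [2 ^ i >= s] the [i]-th summand lies in the [k]-skeleton of
    the grid of mesh [s], in which every point has at most [k] coordinates off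
    [s Z].  Among [k + 1] thresholds in arithmetic progression there is, by
    pigeonhole, one at which no coordinate is at an intermediate distance from
    [s Z] (lemma [gap_ex]).  Taking this threshold as the colour and recording,
    for each coordinate, either the nearby multiple of [s] or the interval
    between two multiples, one obtains [k + 1] families which are [r]-disjoint
    and bounded by [s], whatever [i] is (lemma [skeleton_families]).  Far
    summands are also far from each other, so the families for different [i] can
    be put together.  What remains is contained in finitely many summands, of
    bounded dimension; the same colouring with more thresholds shows that it
    has finite dimension.

    Lower bound.  An ordinal below [omega + k] would give at most [k] families
    [F], bounded by [D] and 1-disjoint, whose complement [B] is covered, at
    every scale, by [m + 1] bounded families, with [m] fixed.  Choose [i] with
    [2 ^ i > D] and [i > k + m].  Two applications of Lebesgue's covering
    theorem at different scales exclude this (lemma [coasdim_lower]).  First,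
    [k] families of sets smaller than [L] cannot cover a [k]-dimensional face of
    the grid, so [B] has a point within [L] of every vertex of the grid.
    Secondly, these points form a coarse copy of an [(m + 1)]-dimensional grid,
    with neighbours at distance at most [2 L]; it cannot be covered by [m + 1]
    families that are [2 L]-disjoint and bounded.

    The covering theorem is reduced to a discrete form for colourings of the
    points of a grid [{0, .., M} ^ n], and that one to a Sperner-type lemma for
    Kuhn's triangulation of the cube ([kuhn_lemma]), proved by a parity count.
    On the ordinal side it only matters that an ordinal below [omega + k] is
    either finite or has limit part [omega] and finite part below [k]. *)

Set Implicit Arguments.
Unset Strict Implicit.
Unset Printing Implicit Defensive.

Import Order.TTheory GRing.Theory Num.Theory.

(** * A Sperner lemma for Kuhn's triangulation of the cube *)

Lemma even_card_involution (T : finType) (A : {set T}) (f : T -> T) :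
  {in A, forall x, [/\ f x \in A, f x != x & f (f x) = x]} -> ~~ odd #|A|.
Proof.
have [m] := ubnP #|A|; elim: m A => // m IH A Am fA.
have [->|[x xA]] := set_0Vmem A; first by rewrite cards0.
have [fxA fxx ffx] := fA _ xA.
rewrite (cardsD1 x) xA (cardsD1 (f x)) !inE fxA fxx /= negbK.
apply: IH => [|y]; first by move: Am; rewrite (cardsD1 x) xA (cardsD1 (f x)) !inE fxA fxx; lia.
rewrite !inE => /and3P[yfx yx yA]; have [fyA fyy ffy] := fA _ yA.
split=> //; rewrite fyA andbT; apply/andP; split; apply/eqP => e.
- by case/eqP: yx; rewrite -ffy e ffx.
- by case/eqP: yfx; rewrite -ffy e.
Qed.

Section kuhn.
Variables (n M : nat).
Local Notation pt := {ffun 'I_n.+1 -> nat}.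
Local Notation simplex := ({ffun 'I_n.+1 -> 'I_M.+1} * 'S_n.+1)%type.
Local Notation flag := (simplex * 'I_n.+2)%type.
Variable l : pt -> option 'I_n.+1.

(** The simplex [(b, q)] lies in the unit cube with least corner [b]; its
    vertices [0, .., n + 1] form a monotone path through the cube on which
    coordinate [t] is incremented at step [q t]. *)
Definition vertex (s : simplex) (i : nat) : pt :=
  [ffun t => (s.1 t + (s.2 t < i))%N].

(** A flag [(s, i)] stands for the facet of [s] opposite to its [i]-th
    vertex. *)
Definition full_facet (p : flag) :=
  [forall j, exists m : 'I_n.+2, (m != p.2) && (l (vertex p.1 m) == Some j)].

(** An inner vertex can always be exchanged inside the cube.  Dropping the first
    (last) vertex leaves the grid only if the coordinate incremented first
    (last) is already maximal (minimal). *)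
Definition on_boundary (p : flag) :=
  (p.2 == ord0) && [exists t, (p.1.2 t == ord0) && (p.1.1 t == ord_max)] ||
  (p.2 == ord_max) && [exists t, (p.1.2 t == ord_max) && (p.1.1 t == ord0)].

Definition cyc : 'S_n.+1 := perm (@ordS_inj n.+1).

(** The other flag with the same facet.  An inner dropped vertex is exchanged by
    swapping two consecutive steps.  Dropping the first vertex lets the path
    continue into the next cube by repeating its first step at the end, which
    rotates [q]; dropping the last vertex is the reverse move. *)
Definition flip (p : flag) : flag :=
  let: (b, q, i) := p in
  if i == ord0 then
    ([ffun t => inord (b t + (q t == ord0))], (q * cyc^-1)%g, ord_max)
  else if i == ord_max then
    ([ffun t => inord (b t - (q t == ord_max))], (q * cyc)%g, ord0)
  else (b, (q * tperm (inord i.-1) (inord i))%g, i).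

Lemma cycE t : cyc t = ordS t.
Proof. by rewrite permE. Qed.

Lemma cycVE t : (cyc^-1)%g t = ord_pred t.
Proof. by apply: (perm_inj (s := cyc)); rewrite permKV cycE ord_predK. Qed.

Lemma val_ordS (t : 'I_n.+1) : ordS t = (if t == ord_max then 0 else t.+1) :> nat.
Proof.
rewrite /= -val_eqE /=; case: eqP => [->|tn]; first by rewrite modnn.
by rewrite modn_small //; have := ltn_ord t; lia.
Qed.

Lemma val_ord_pred (t : 'I_n.+1) : ord_pred t = (if t == ord0 then n else t.-1) :> nat.
Proof.
rewrite /= -val_eqE /=; case: eqP => [->|tn]; first by rewrite add0n modn_small.
have -> : ((t + n.+1).-1 = t.-1 + n.+1)%N by lia.
by rewrite modnDr modn_small //; have := ltn_ord t; lia.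
Qed.

Lemma ordS_eq0 (t : 'I_n.+1) : (ordS t == ord0) = (t == ord_max).
Proof.
apply/eqP/eqP => [/(congr1 (@nat_of_ord n.+1))|->]; [|apply: ord_inj].
  by rewrite val_ordS; case: eqP.
by rewrite val_ordS eqxx.
Qed.

Lemma ord_pred_eq_max (t : 'I_n.+1) : (ord_pred t == ord_max) = (t == ord0).
Proof.
apply/eqP/eqP => [/(congr1 (@nat_of_ord n.+1))|->]; [|apply: ord_inj]; rewrite val_ord_pred ?eqxx//.
case: eqVneq => //; rewrite -val_eqE /=; have := ltn_ord t; lia.
Qed.

Lemma flip_first b q : flip (b, q, ord0) =
  ([ffun t => inord (b t + (q t == ord0))], (q * cyc^-1)%g, ord_max).
Proof. by []. Qed.

Lemma flip_last b q : flip (b, q, ord_max) =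
  ([ffun t => inord (b t - (q t == ord_max))], (q * cyc)%g, ord0).
Proof. by rewrite /flip eqxx. Qed.

Lemma flip_inner b q (i : 'I_n.+2) : i != ord0 -> i != ord_max ->
  flip (b, q, i) = (b, (q * tperm (inord i.-1) (inord i))%g, i).
Proof. by rewrite /flip => /negPf-> /negPf->. Qed.

Lemma boundary_first b q : on_boundary (b, q, ord0) =
  [exists t, (q t == ord0) && (b t == ord_max)].
Proof. by rewrite /on_boundary /= orbF. Qed.

Lemma boundary_last b q : on_boundary (b, q, ord_max) =
  [exists t, (q t == ord_max) && (b t == ord0)].
Proof. by rewrite /on_boundary eqxx. Qed.

Lemma boundary_inner b q (i : 'I_n.+2) : i != ord0 -> i != ord_max ->
  on_boundary (b, q, i) = false.
Proof. by rewrite /on_boundary /= => /negPf-> /negPf->. Qed.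

Lemma flip_fix p : flip p != p.
Proof.
case: p => [[b q] i]; case: (eqVneq i ord0) => [->|i0].
  by apply/eqP => -[].
case: (eqVneq i ord_max) => [->|im]; first by rewrite flip_last; apply/eqP => -[].
rewrite flip_inner//; apply/eqP => -[] /(congr1 (fun s => (q^-1 * s)%g)); rewrite mulKg mulVg => e.
have := congr1 (fun s : 'S__ => s (inord i.-1)) e; rewrite tpermL perm1.
move/(congr1 val); rewrite /= !inordK; move: i0 im; rewrite -!val_eqE /=; have := ltn_ord i; lia.
Qed.

Lemma flipP p : ~~ on_boundary p ->
  ~~ on_boundary (flip p) /\ flip (flip p) = p.
Proof.
case: p => [[b q] i]; case: (eqVneq i ord0) => [->|i0].
  rewrite boundary_first negb_exists flip_first boundary_last flip_last => /forallP H.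
  have bE t : q t = ord0 -> (b t < M)%N.
    by move=> qt; have := H t; rewrite qt eqxx /= -val_eqE /=; have := ltn_ord (b t); lia.
  split.
    rewrite negb_exists; apply/forallP => t; rewrite ffunE permM cycVE ord_pred_eq_max.
    by case: eqVneq => //= /bE bt; rewrite -val_eqE /= inordK; lia.
  congr (_, _, _); last by rewrite mulgKV.
  apply/ffunP => t; apply: val_inj; rewrite !ffunE permM cycVE ord_pred_eq_max /=.
  case: eqVneq => /= [/bE bt|_]; first by rewrite !inordK; lia.
  by rewrite subn0 inord_val addn0 inord_val.
case: (eqVneq i ord_max) => [->|im].
  rewrite boundary_last negb_exists flip_last boundary_first flip_first => /forallP H.
  have bE t : q t = ord_max -> (0 < b t)%N.
    by move=> qt; have := H t; rewrite qt eqxx /= -val_eqE /=; lia.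
  split.
    rewrite negb_exists; apply/forallP => t; rewrite ffunE permM cycE ordS_eq0.
    by case: eqVneq => //= /bE bt; rewrite -val_eqE /= inordK; have := ltn_ord (b t); lia.
  congr (_, _, _); last by rewrite mulgK.
  apply/ffunP => t; apply: val_inj; rewrite !ffunE permM cycE ordS_eq0 /=.
  have := ltn_ord (b t) => b1.
  case: eqVneq => /= [/bE bt|_]; first by rewrite !inordK; lia.
  by rewrite subn0 inord_val addn0 inord_val.
by move=> _; rewrite !flip_inner// boundary_inner// -mulgA tperm2 mulg1.
Qed.

Lemma flip_vertex p (m : 'I_n.+2) : ~~ on_boundary p -> m != p.2 ->
  exists2 m' : 'I_n.+2, m' != (flip p).2 & vertex (flip p).1 m' = vertex p.1 m.
Proof.
case: p => [[b q] i]; case: (eqVneq i ord0) => [->|i0].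
  rewrite boundary_first negb_exists flip_first => /forallP H /= m0.
  exists (inord m.-1).
    by rewrite -val_eqE /= inordK; move: m0; rewrite -val_eqE /=; have := ltn_ord m; lia.
  apply/ffunP => t; rewrite !ffunE permM cycVE val_ord_pred /=.
  have := ltn_ord (q t); have := ltn_ord (b t); have := ltn_ord m; move: m0 (H t).
  rewrite -!val_eqE /= => m0 Ht m1 b1 q1.
  by rewrite !inordK; [case: eqP Ht => ? ?; lia|case: eqP Ht => ? ?; lia|lia..].
case: (eqVneq i ord_max) => [->|im].
  rewrite boundary_last negb_exists flip_last => /forallP H /= m0.
  exists (inord m.+1).
    by rewrite -val_eqE /= inordK; move: m0; rewrite -val_eqE /=; have := ltn_ord m; lia.
  apply/ffunP => t; rewrite !ffunE permM cycE val_ordS /=.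
  have := ltn_ord (q t); have := ltn_ord (b t); have := ltn_ord m; move: m0 (H t).
  rewrite -!val_eqE /= => m0 Ht m1 b1 q1.
  by rewrite !inordK; [case: eqP Ht => ? ?; lia|lia..].
move=> _; rewrite flip_inner//= => mi; exists m => //; apply/ffunP => t.
rewrite !ffunE permM; congr (_ + nat_of_bool _)%N.
move: i0 im mi; rewrite -!val_eqE /= => i0 im mi; have := ltn_ord i => i1.
by case: tpermP => [->|->|//]; rewrite !inordK; lia.
Qed.

Lemma flip_full p : ~~ on_boundary p -> full_facet p -> full_facet (flip p).
Proof.
move=> bp /forallP fp; apply/forallP => j.
have /existsP[m /andP[mp lm]] := fp j.
by have [m' ? e] := flip_vertex bp mp; apply/existsP; exists m'; rewrite e lm andbT.
Qed.

(** Prescribing all labels on the faces through the origin leaves a single full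
    facet on the boundary, so that the parity count needs no induction on the
    dimension. *)
Hypothesis l_high : forall (x : pt) j, (forall t, x t <= M.+1)%N -> x j = M.+1 -> l x <> Some j.
Hypothesis l_low : forall (x : pt) j, (forall t, x t <= M.+1)%N -> x j = 0 ->
  (forall t : 'I_n.+1, (t < j)%N -> x t <> 0) -> l x = Some j.

Lemma vertex_le s i t : (vertex s i t <= M.+1)%N.
Proof. by rewrite ffunE; have := ltn_ord (s.1 t); case: (_ < i)%N; lia. Qed.

Lemma perm_mono_id (q : 'S_n.+1) :
  (forall t u : 'I_n.+1, (t < u)%N -> (q t < q u)%N) -> q = 1%g.
Proof.
move=> qm; apply/permP => t; rewrite perm1; apply: ord_inj; apply/eqP; rewrite eqn_leq.
apply/andP; split.
  have [m] := ubnP (n - t); elim: m t => // m IH t tm.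
  have [tn|tn] := leqP n t; first by have := ltn_ord (q t); lia.
  have e : inord t.+1 = t.+1 :> nat := @inordK n t.+1 tn.
  have := qm t (inord t.+1); have := IH (inord t.+1); rewrite e /= => /(_ ltac:(lia)); lia.
case: t => t tn /=; elim: t tn => // t IH tn.
have := IH (ltnW tn); have := qm (Ordinal (ltnW tn)) (Ordinal tn) (ltnSn _); lia.
Qed.

(** On a face [x t = M + 1] the label [t] is missing.  On a face [x t = 0] the
    label is at most [t], hence a full facet has [t = n]; there the vertex
    labelled [j] has coordinate [j] zero and the earlier ones positive, which
    forces the path of the origin cube that increments the coordinates in
    order. *)
Lemma full_boundary p : full_facet p && on_boundary p = (p == ([ffun=> ord0], 1%g, ord_max)).
Proof.
apply/idP/eqP => [/andP[]|->]; last first.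
  apply/andP; split; last first.
    rewrite boundary_last; apply/existsP; exists ord_max.
    by rewrite ffunE perm1 !eqxx.
  apply/forallP => j; apply/existsP; exists (inord j).
  rewrite -val_eqE /= inordK ?(leqW (ltn_ord j))// neq_ltn ltn_ord /=; apply/eqP.
  apply: l_low => [t||t tj]; rewrite ?vertex_le// !ffunE perm1 ?ltnn //= tj; lia.
case: p => [[b q] i] /forallP/= fp /orP[|]/andP[/= /eqP i0 /existsP[t /andP[/eqP qt /eqP bt]]].
  have /existsP[m /andP[mi /eqP lm]] := fp t; case: (l_high _ _ lm); first exact: vertex_le.
  by move: mi; rewrite !ffunE /= qt bt i0 -val_eqE /=; case: (val m) => //= *; lia.
have vt (m : 'I_n.+2) : m != i -> exists2 j : 'I_n.+1, [/\ (j <= t)%N, vertex (b, q) m j = 0 &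
    (forall u : 'I_n.+1, (u < j)%N -> vertex (b, q) m u <> 0)] & l (vertex (b, q) m) = Some j.
  move=> mi; have m0 : vertex (b, q) m t == 0.
    move: mi; rewrite ffunE /= qt bt i0 -val_eqE /=; have := ltn_ord m; lia.
  have [j /eqP j0 jm] := @arg_minnP _ t (fun u => vertex (b, q) m u == 0) (@nat_of_ord n.+1) m0.
  have jmin (u : 'I_n.+1) : (u < j)%N -> vertex (b, q) m u <> 0.
    by move=> uj /eqP/jm; rewrite leqNgt uj.
  by exists j; [split => //; exact: jm|apply: l_low => // u; exact: vertex_le].
have wt (j : 'I_n.+1) : exists m : 'I_n.+2, [/\ (j <= t)%N, vertex (b, q) m j = 0 &
    (forall u : 'I_n.+1, (u < j)%N -> vertex (b, q) m u <> 0)].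
  have /existsP[m /andP[mi /eqP lm]] := fp j; exists m.
  by have [j' H] := vt m mi; rewrite lm => -[->].
have b0 j : b j = ord0.
  have [m [_ + _]] := wt j; rewrite ffunE /= => /eqP; rewrite addn_eq0 => /andP[/eqP bj _].
  exact: val_inj.
rewrite i0; congr (_, _, _); first by apply/ffunP => j; rewrite b0 ffunE.
apply: perm_mono_id => u j uj.
have [m [_ mj /(_ u uj)]] := wt j; move: mj; rewrite !ffunE /= !b0 /=; lia.
Qed.

(** If a simplex with a full facet has no unlabelled vertex, then exactly one
    label occurs twice, and its full facets are those opposite to the two
    vertices with that label. *)
Lemma full_facet_even : ~~ [exists p, full_facet p && (l (vertex p.1 p.2) == None)] ->
  ~~ odd #|[set p | full_facet p]|.
Proof.
rewrite negb_exists => /forallP nr.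
pose twin (p : flag) : flag := (p.1, odflt p.2
  [pick m | (m != p.2) && (l (vertex p.1 m) == l (vertex p.1 p.2))]).
apply: (even_card_involution (f := twin)) => -[s i]; rewrite inE => fp.
have lbl j : exists2 m : 'I_n.+2, m != i & l (vertex s m) = Some j.
  by have /existsP[m /andP[? /eqP ?]] := forallP fp j; exists m.
have := nr (s, i); rewrite fp /=; case ej : (l (vertex s i)) => [j|//] _.
have inj m1 m2 : m1 != i -> m2 != i -> l (vertex s m1) = l (vertex s m2) -> m1 = m2.
  (* otherwise the n + 1 labels would be attained on n vertices only *)
  move=> m1i m2i e; apply/eqP/negP => /negP m12.
  have: (#|[set Some j' | j' : 'I_n.+1]| <=
         #|(fun m : 'I_n.+2 => l (vertex s m)) @: (~: [set i; m2])|)%N.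
    apply/subset_leq_card/fintype.subsetP => _ /imsetP[j' _ ->]; have [m mi <-] := lbl j'.
    have [->|mm] := eqVneq m m2; first by rewrite -e imset_f// !inE negb_or m1i.
    by apply: (imset_f (fun m : 'I_n.+2 => l (vertex s m))); rewrite !inE negb_or mi.
  rewrite leqNgt => /negP; apply; apply: leq_ltn_trans (leq_imset_card _ _) _.
  have := cardsCs [set i; m2]; rewrite cards2 eq_sym m2i card_ord => c2.
  rewrite card_imset; last by move=> ? ? [].
  by rewrite card_ord; have := max_card (mem (~: [set i; m2])); rewrite card_ord; lia.
have [m mi lm] := lbl j.
have tw : twin (s, i) = (s, m).
  rewrite /twin /=; case: pickP => [m' /andP[m'i /eqP e]|/(_ m)]; last by rewrite mi lm ej eqxx.
  by congr (_, _); apply: inj => //; rewrite e lm ej.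
rewrite tw inE; split.
- apply/forallP => j'; apply/existsP => /=; have [->|jj] := eqVneq j' j.
    by exists i; rewrite eq_sym mi ej eqxx.
  have [m' m'i lm'] := lbl j'; exists m'; rewrite lm' eqxx andbT.
  by apply: contra_neq jj => mm; move: lm'; rewrite mm lm => -[].
- by apply/eqP => -[e]; rewrite e eqxx in mi.
- rewrite /twin /=; case: pickP => [m' /andP[m'm /eqP e]|/(_ i)]; last first.
    by rewrite eq_sym mi lm ej eqxx.
  congr (_, _); apply/eqP/negP => /negP m'i.
  by case/eqP: m'm; apply: inj.
Qed.

(** Without a completely labelled simplex, the number of full flags would be
    even by [full_facet_even].  But [flip] pairs the full flags off the boundary,
    and by [full_boundary] there is exactly one on the boundary. *)
Theorem kuhn_lemma : exists b : pt, (forall t, b t <= M)%N /\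
  forall c, exists2 x : pt, (forall t, b t <= x t <= (b t).+1)%N & l x = c.
Proof.
have [|/full_facet_even ev] := boolP [exists p, full_facet p && (l (vertex p.1 p.2) == None)].
  move=> /existsP[[s i] /andP[/forallP fp /eqP /= ln]].
  exists [ffun t => val (s.1 t)]; split=> [t|c]; first by rewrite ffunE -ltnS ltn_ord.
  have vc (m : 'I_n.+2) t :
      ([ffun t => val (s.1 t)] t <= vertex s m t <= ([ffun t => val (s.1 t)] t).+1)%N.
    by rewrite !ffunE /= leq_addr /=; case: (_ < m)%N; rewrite ?addn1 ?addn0.
  case: c => [j|]; last by exists (vertex s i).
  by have /existsP[m /andP[_ /eqP lm]] := fp j; exists (vertex s m).
have : ~~ odd #|[set p | full_facet p && ~~ on_boundary p]|.
  apply: (even_card_involution (f := flip)) => p; rewrite !inE => /andP[fp bp].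
  by have [-> ->] := flipP bp; rewrite flip_full// flip_fix.
move: ev; rewrite -(cardsID [set p | on_boundary p] [set p | full_facet p]) oddD.
have -> : #|[set p | full_facet p] :&: [set p | on_boundary p]| = 1%N.
  rewrite -[RHS](cards1 (([ffun=> ord0], 1%g, ord_max) : flag)).
  congr #|pred_of_set _|; apply/setP => p.
  by rewrite !inE full_boundary.
have -> : [set p | full_facet p] :\: [set p | on_boundary p] =
    [set p | full_facet p && ~~ on_boundary p].
  by apply/setP => p; rewrite !inE andbC.
by move=> /= /negPn ->.
Qed.

End kuhn.

(** * Lebesgue's covering theorem *)

(** If no piece of any colour [j] joined the two faces in direction [j], one
    could add a layer of points below the low faces and apply [kuhn_lemma] as
    follows.  Label the points of
    the layer by their first zero coordinate, the points whose piece touches the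
    low face of its own direction by their colour, and leave the others
    unlabelled.  In a completely labelled unit cube the unlabelled point, of
    colour [j] say, would be in the piece of the point labelled [j], or on the low
    face in direction [j], and so would have a label in both cases. *)
Lemma discrete_lebesgue n M (T : Type) (c : {ffun 'I_n.+1 -> nat} -> 'I_n.+1)
    (piece : {ffun 'I_n.+1 -> nat} -> T) :
  (forall x y : {ffun 'I_n.+1 -> nat}, (forall t, x t <= M)%N -> (forall t, y t <= M)%N ->
     (forall t, x t <= (y t).+1 /\ y t <= (x t).+1)%N -> c x = c y -> piece x = piece y) ->
  exists x y : {ffun 'I_n.+1 -> nat}, [/\ (forall t, x t <= M)%N, (forall t, y t <= M)%N,
     c x = c y, piece x = piece y & x (c x) = 0%N /\ y (c x) = M].
Proof.
move=> cont; apply: contrapT => /forallNP nxy.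
pose low x := `[< exists y : {ffun 'I_n.+1 -> nat},
  [/\ forall t, (y t <= M)%N, c y = c x, piece y = piece x & y (c x) = 0%N] >].
pose down (x : {ffun 'I_n.+1 -> nat}) : {ffun 'I_n.+1 -> nat} := [ffun t => (x t).-1].
pose first0 (x : {ffun 'I_n.+1 -> nat}) j :=
  (x j == 0%N) && [forall t : 'I_n.+1, (t < j)%N ==> (x t != 0%N)].
pose l x := if [pick j | first0 x j] is Some j then Some j
  else if low (down x) then Some (c (down x)) else None.
have first0_inj x i j : first0 x i -> first0 x j -> i = j.
  move=> /andP[xi /forallP mi] /andP[xj /forallP mj]; apply/eqP.
  have := mi j; have := mj i; rewrite xi xj -val_eqE /=; lia.
have first0_ex (x : {ffun 'I_n.+1 -> nat}) j : x j = 0%N -> exists i, first0 x i.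
  move=> /eqP xj; have [i xi im] := @arg_minnP _ j (fun i => x i == 0%N) (@nat_of_ord n.+1) xj.
  exists i; rewrite /first0 xi; apply/forallP => t; apply/implyP => ti.
  by apply: contraL ti => /im; rewrite leqNgt.
have [||b [bM rainbow]] := @kuhn_lemma n M l.
- move=> x j xM xj; rewrite /l; case: pickP => [i /andP[/eqP xi _] [e]|x0].
    by move: xi; rewrite e xj.
  rewrite /low; case: asboolP => // -[y [yM cy py y0]] [e].
  apply: (nxy y); exists (down x); split => //.
  - by move=> t; rewrite ffunE; have := xM t; lia.
  - by split; rewrite cy// e /down ffunE xj.
- move=> x j xM xj mj; rewrite /l; case: pickP => [i fi|/(_ j)].
    congr Some; apply: first0_inj fi _; rewrite /first0 xj eqxx; apply/forallP => t.
    by apply/implyP => /mj /eqP.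
  rewrite /first0 xj eqxx /= => /negP[]; apply/forallP => t.
  by apply/implyP => /mj /eqP.
have [u bu] := rainbow None.
rewrite /l; case: pickP => // u0; case: ifP => // lowu _.
have u_gt0 t : (0 < u t)%N.
  by rewrite lt0n; apply/eqP => /first0_ex[i]; rewrite u0.
have uM t : (down u t <= M)%N by rewrite ffunE; have := bu t; have := bM t; lia.
have [w bw] := rainbow (Some (c (down u))).
rewrite /l; case: pickP => [j /andP[/eqP wj _] [ej]|w0].
  move/negP: lowu; apply; apply/asboolP; exists (down u); split => //.
  rewrite -ej ffunE; have := bw j; have := bu j; have := u_gt0 j; rewrite wj; lia.
have w_gt0 t : (0 < w t)%N.
  by rewrite lt0n; apply/eqP => /first0_ex[i]; rewrite w0.
rewrite /low; case: asboolP => // -[y [yM cy py y0]] [e].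
move/negP: lowu; apply; apply/asboolP; exists y; split => //.
- by rewrite cy e.
- rewrite py; apply: cont => // t; rewrite !ffunE.
    by have := bw t; have := bM t; lia.
  by have := bw t; have := bu t; have := w_gt0 t; have := u_gt0 t; lia.
- by rewrite -e.
Qed.

Local Open Scope classical_set_scope.
Local Open Scope ring_scope.

Lemma uniformly_boundedP (R : realType) (X : metricType R) (F : set (set X)) :
  uniformly_bounded F <->
  exists D : R, forall U x y, F U -> U x -> U y -> mdist x y <= D.
Proof.
rewrite /uniformly_bounded; split => [|[D FD]]; last first.
  apply: (@le_lt_trans _ _ D%:E); last exact: ltry.
  apply: ge_ereal_sup => _ [U FU <-]; apply: ge_ereal_sup => _ [x Ux [y Uy <-]].
  by rewrite lee_fin; exact: FD FU Ux Uy.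
set s := ereal_sup _ => soo; exists (fine s) => U x y FU Ux Uy.
have : ((mdist x y)%:E <= s)%E.
  apply: (@le_trans _ _ (diam U)); apply: ereal_sup_ubound; last by exists U.
  by exists x => //; exists y.
by case: s soo => [v| |] //=; rewrite lee_fin.
Qed.

Lemma uniformly_bounded_fin (R : realType) (X : metricType R) n
    (F : 'I_n -> set (set X)) : (forall j, uniformly_bounded (F j)) ->
  exists D : R, forall j U x y, F j U -> U x -> U y -> mdist x y <= D.
Proof.
move=> Fb; have /choice[D DP] : forall j, exists D : R, forall U x y,
    F j U -> U x -> U y -> mdist x y <= D.
  by move=> j; apply/uniformly_boundedP.
exists (\sum_j `|D j|) => j U x y FU Ux Uy.
rewrite (le_trans (DP j U x y FU Ux Uy))// (bigD1 j)//= -[leLHS]addr0.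
by rewrite lerD ?ler_norm// sumr_ge0.
Qed.

Lemma r_disjoint_eq (R : realType) (X : metricType R) (r : R) (F : set (set X)) U V x y :
  r_disjoint r F -> F U -> F V -> U x -> V y -> mdist x y <= r -> U = V.
Proof.
move=> Fr FU FV Ux Vy xy; apply: contrapT => /(Fr _ _ FU FV).
rewrite ltNge => /negP; apply; apply: le_trans (_ : ((mdist x y)%:E <= _)%E).
  by apply: ereal_inf_lbound; exists x => //; exists y.
by rewrite lee_fin.
Qed.

(** The grid is mapped to [X] with steps at most [r], so neighbouring points of
    the same colour are in the same member of an [r]-disjoint family. *)
Lemma lebesgue_covering (R : realType) (X : metricType R) n M (r : R)
    (F : 'I_n.+1 -> set (set X)) (h : {ffun 'I_n.+1 -> nat} -> X) :
  (forall j, r_disjoint r (F j)) ->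
  (forall x y : {ffun 'I_n.+1 -> nat}, (forall t, x t <= M)%N -> (forall t, y t <= M)%N ->
     (forall t, x t <= (y t).+1 /\ y t <= (x t).+1)%N -> mdist (h x) (h y) <= r) ->
  (forall (x y : {ffun 'I_n.+1 -> nat}) j U, (forall t, x t <= M)%N -> (forall t, y t <= M)%N ->
     x j = 0%N -> y j = M -> F j U -> U (h x) -> U (h y) -> False) ->
  exists x : {ffun 'I_n.+1 -> nat}, (forall t, x t <= M)%N /\ forall j U, F j U -> ~ U (h x).
Proof.
move=> Fr cont far; apply: contrapT => /forallNP nx.
have /choice[cp cpP] : forall x : {ffun 'I_n.+1 -> nat}, exists p : 'I_n.+1 * set X,
    (forall t, x t <= M)%N -> F p.1 p.2 /\ p.2 (h x).
  move=> x; have [xM|xM] := pselect (forall t, (x t <= M)%N); last by exists (ord0, set0).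
  have /not_andP[//|/existsNP[j /existsNP[U /not_implyP[FU /contrapT Ux]]]] := nx x.
  by exists (j, U).
have [x y xM yM xy e|x [y [xM yM cxy pxy [x0 yMM]]]] :=
  @discrete_lebesgue n M _ (fst \o cp) (snd \o cp).
  have [Fx Ux] := cpP _ xM; have [Fy Uy] := cpP _ yM.
  rewrite /= in e *; rewrite -e in Fy.
  exact: (r_disjoint_eq (Fr _) Fx Fy Ux Uy (cont _ _ xM yM xy)).
have [Fx Ux] := cpP _ xM; have [Fy Uy] := cpP _ yM.
rewrite /= in cxy pxy; rewrite -pxy in Uy.
exact: (far x y _ _ xM yM x0 yMM Fx Ux Uy).
Qed.

(** * Ordinals up to [omega + k] *)

Lemma ord_lt_total a b : ord_lt a b \/ ord_le b a.
Proof.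
elim: a b => A f IH [B g]; have [?|nba] := pselect (ord_le (Osup g) (Osup f)); [by right|left].
have /existsNP[j /forallNP nj] := nba.
exists j; case: (g j) nj => C h nj i.
by have [|/nj] := IH i (Osup h).
Qed.

Lemma ord_lt_le_trans b a c : ord_lt a b -> ord_le b c -> ord_lt a c.
Proof.
case: b c => [B g] [C h] [j aj] /(_ j)[l gh].
by exists l; exact: ord_le_trans gh.
Qed.

Lemma ord_le_lt_trans b a c : ord_le a b -> ord_lt b c -> ord_lt a c.
Proof. by case: c => [C h] ab [l bl]; exists l; exact: ord_le_trans bl. Qed.

Lemma ord_lt_irrefl a : ~ ord_lt a a.
Proof. by elim/(well_founded_ind ord_lt_wf): a => a IH aa; exact: (IH a aa). Qed.

Lemma ord_lt_geF a b : ord_lt a b -> ~ ord_le b a.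
Proof. by move=> ab ba; exact: ord_lt_irrefl (ord_lt_le_trans ab ba). Qed.

Lemma ord_ltS a b : ord_lt a (Osucc b) <-> ord_le a b.
Proof. by split=> [[]|ab]; [|exists tt]. Qed.

Lemma ord_leSl a b : ord_le (Osucc a) b <-> ord_lt a b.
Proof. by case: b => B g; split=> [/(_ tt)|ag []]. Qed.

Lemma Oaddn_le2 a b n : ord_le a b -> ord_le (Oaddn a n) (Oaddn b n).
Proof. by move=> ab; elim: n => // n IH; exact: ord_leS. Qed.

Lemma Oaddn_leD a n m : (n <= m)%N -> ord_le (Oaddn a n) (Oaddn a m).
Proof.
elim: m => [|m IH]; first by rewrite leqn0 => /eqP->; exact: ord_le_refl.
rewrite leq_eqVlt => /predU1P[->|/IH]; first exact: ord_le_refl.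
by move=> nm; apply: ord_ltW; apply/ord_ltS.
Qed.

Lemma Ozero_le a : ord_le Ozero a.
Proof. by case: a => A f []. Qed.

Lemma finite_lt_omega m : ord_lt (Oaddn Ozero m) Oomega.
Proof. by exists m; exact: ord_le_refl. Qed.

Lemma Oomega_limit : limit_or_zero Oomega.
Proof.
move=> [b [ob bo]].
have /ord_leSl[m bm] := bo.
exact: ord_lt_geF (finite_lt_omega m.+1) (ord_le_trans ob (ord_leS bm)).
Qed.

Lemma limit_succ_lt l a : limit_or_zero l -> ord_lt a l -> ord_lt (Osucc a) l.
Proof.
move=> ll /ord_leSl al; have [//|la] := ord_lt_total (Osucc a) l.
by case: ll; exists a.
Qed.

Lemma limit_Oaddn_lt l a n : limit_or_zero l -> ord_lt a l -> ord_lt (Oaddn a n) l.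
Proof. by move=> ll al; elim: n => // n IH; exact: limit_succ_lt. Qed.

Lemma limit_lt_omega_eq0 l b : limit_or_zero l -> ord_lt l Oomega -> ~ ord_lt b l.
Proof.
move=> ll [m lm] bl; apply: (ord_lt_geF _ lm).
exact/(limit_Oaddn_lt m ll)/(ord_le_lt_trans (Ozero_le b)).
Qed.

Lemma Oaddn_lt_omega a n : ord_lt a Oomega -> ord_lt (Oaddn a n) Oomega.
Proof. exact: limit_Oaddn_lt Oomega_limit. Qed.

(** If [l < omega] then [l + n < omega]; and if some [a >= omega] were below the
    limit ordinal [l], then also [omega + k < l]. *)
Lemma decomposition_lt_omegaD k b l n : limit_or_zero l -> ord_eq b (Oaddn l n) ->
  ord_lt b (Oaddn Oomega k) -> ord_le Oomega b ->
  (n < k)%N /\ forall a, ord_lt a l -> ord_lt a Oomega.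
Proof.
move=> ll [bln lnb] bk ob.
have ol : ord_le Oomega l.
  have [lo|//] := ord_lt_total l Oomega.
  by case: (ord_lt_geF (Oaddn_lt_omega n lo)); exact: ord_le_trans bln.
split=> [|a al].
  rewrite ltnNge; apply/negP => kn; apply: (ord_lt_geF bk); apply: ord_le_trans lnb.
  exact: ord_le_trans (Oaddn_leD _ kn) (Oaddn_le2 n ol).
have [//|oa] := ord_lt_total a Oomega.
case: (ord_lt_geF bk); apply: ord_ltW; apply: (ord_lt_le_trans (b := l)).
  by apply: limit_Oaddn_lt => //; exact: ord_le_lt_trans al.
by apply: ord_le_trans lnb; rewrite -[l in X in ord_le X _]/(Oaddn l 0); exact: Oaddn_leD.
Qed.

Lemma coasdim_le_inv (R : realType) (X : metricType R) (A : set X) b : coasdim_le A b ->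
  exists l n, [/\ limit_or_zero l, ord_eq b (Oaddn l n) &
  forall r : R, 0 < r -> exists F : 'I_n.+1 -> set (set X),
    [/\ forall i U, F i U -> U `<=` A, forall i, r_disjoint r (F i),
        forall i, uniformly_bounded (F i) &
        let B := A `\` \bigcup_i \bigcup_(U in F i) U in
        B = set0 \/ exists2 c, ord_lt c l & coasdim_le B c]].
Proof. by case=> {}A {}b l n ll bE H; exists l, n. Qed.

(** The limit part of [b] is a limit ordinal below [omega], hence zero: no
    remainder is allowed. *)
Lemma coasdim_lt_omega (R : realType) (X : metricType R) (A : set X) b :
  ord_lt b Oomega -> coasdim_le A b -> exists m, forall r : R, 0 < r ->
  exists G : 'I_m.+1 -> set (set X), [/\ forall j, r_disjoint r (G j),
    forall j, uniformly_bounded (G j) & A `<=` \bigcup_j \bigcup_(U in G j) U].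
Proof.
move=> bo /coasdim_le_inv[l [n [ll [bln lnb] H]]]; exists n => r r0.
have lo : ord_lt l Oomega.
  apply: ord_le_lt_trans bo; apply: ord_le_trans lnb.
  exact: (Oaddn_leD l (leq0n n)).
have [F [_ Fr Fb [AF|[c cl _]]]] := H r r0; last by case: (limit_lt_omega_eq0 ll lo cl).
by exists F; split => //; rewrite -setD_eq0.
Qed.

(** * The lower bound *)

Section lower_bound.
Variables (R : realType) (k : nat).
Local Notation seqR := {fsfun nat -> R with 0}.

Definition truncate (i : nat) (f : nat -> R) : finseq R :=
  [fsfun j in [fset j in iota 0 i]%fset => f j | 0].

Lemma truncateE i f (j : nat) : (truncate i f : seqR) j = if (j < i)%N then f j else 0.
Proof.
rewrite /truncate fsfun_fun; case: ifP => [|/negP ji].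
  by rewrite !inE /= mem_iota add0n => /andP[_ ->].
by case: ifP => // ji'; case: ji; rewrite !inE /= mem_iota.
Qed.

Lemma dmax_le (x y : finseq R) (d : R) : 0 <= d ->
  (forall j : nat, `|(x : seqR) j - (y : seqR) j| <= d) -> mdist x y <= d.
Proof. by move=> d0 xy; apply: bigmax_le => // j _; exact: xy. Qed.

Lemma le_mdist (x y : finseq R) (j : nat) :
  `|(x : seqR) j - (y : seqR) j| <= mdist x y.
Proof. exact: le_dmax. Qed.

Lemma Xomega_dist (p q : Xomega R k) : mdist p q =
  mdist (val p).2 (val q).2 +
  (\sum_(minn (val p).1 (val q).1 <= j < maxn (val p).1 (val q).1) j)%N%:R.
Proof. by case: p q => [[l x] ?] [[l' y] ?]. Qed.

Lemma Xomega_dist_same (p q : Xomega R k) : (val p).1 = (val q).1 ->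
  mdist p q = mdist (val p).2 (val q).2.
Proof. by move=> e; rewrite Xomega_dist e minnn maxnn big_geq// addr0. Qed.

Lemma Xomega_point i (x : finseq R) : (0 < i)%N -> Xpart R k i x ->
  exists p : Xomega R k, val p = (i, x).
Proof.
move=> i0 Xx; have H : (0 < (i, x).1)%N && ((i, x).2 \in Xpart R k (i, x).1).
  by rewrite /= i0; apply/mem_set.
by exists (exist _ (i, x) H).
Qed.

Lemma multiplesM (a : R) n : multiples a (a * n%:R).
Proof. by exists n%:Z. Qed.

Lemma truncate_Xpart i n (f : nat -> R) : (n <= k)%N ->
  (forall j : nat, (n <= j)%N -> multiples (2 ^+ i : R) (f j)) ->
  Xpart R k i (truncate i f).
Proof.
move=> nk fm; split=> [j ij|]; first by rewrite truncateE ltnNge ij.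
apply: leq_trans nk; apply: (@leq_trans #|[pred j : 'I_i | (j < n)%N]|).
  apply: subset_leq_card; apply/fintype.subsetP => j; rewrite !inE truncateE ltn_ord.
  by apply: contraNT; rewrite -leqNgt => /fm ?; apply/mem_set.
rewrite cardE -(size_map (@nat_of_ord i)) -[leqRHS](size_iota 0).
apply: uniq_leq_size; first by rewrite map_inj_uniq ?enum_uniq//; exact: ord_inj.
by move=> _ /mapP[j + ->]; rewrite mem_enum inE mem_iota add0n.
Qed.

(** At scale 1 the families [F] miss a point of every large [(n + 1)]-dimensional
    face of the skeleton.  Seen at the scale of the mesh, these points form an
    [(m + 1)]-dimensional grid, which the families [G] cannot cover.  Thus [r]
    depends on [F], through the mesh, but not on [G]. *)
Lemma coasdim_lower n m (F : 'I_n.+1 -> set (set (Xomega R k))) : (n < k)%N ->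
  (forall j, r_disjoint 1 (F j)) -> (forall j, uniformly_bounded (F j)) ->
  exists2 r : R, 0 < r & forall G : 'I_m.+1 -> set (set (Xomega R k)),
  (forall j, r_disjoint r (G j)) -> (forall j, uniformly_bounded (G j)) ->
  exists p, forall U, (forall j, F j U -> ~ U p) /\ (forall j, G j U -> ~ U p).
Proof.
move=> nk Fr Fb.
have [D FD] := uniformly_bounded_fin Fb.
(* the face must be larger than D, and there must be room for both grids *)
pose i := (k + m.+1 + Num.bound `|D|)%N.
have pow_gt : D < (2 ^ i)%N%:R.
  rewrite (le_lt_trans (ler_norm _))// (lt_le_trans (archi_boundP _))// ler_nat.
  by rewrite (leq_trans _ (ltnW (ltn_expl i _)))// leq_addl.
pose L : R := 2 ^+ i.
have LE : (2 ^ i)%N%:R = L by rewrite natrX.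
have L1 : 1 <= L by rewrite -LE ler1n expn_gt0.
exists (2 * L) => [|G Gr Gb]; first by lra.
pose coord d (x : {ffun 'I_d.+1 -> nat}) (j : nat) : nat :=
  if insub j is Some t then x t else 0%N.
have coordE d (x : {ffun 'I_d.+1 -> nat}) (t : 'I_d.+1) : coord d x t = x t.
  by rewrite /coord valK.
have coord0 d (x : {ffun 'I_d.+1 -> nat}) j : (d < j)%N -> coord d x j = 0%N.
  by move=> dj; rewrite /coord insubF// ltnS leqNgt dj.
have coord_le d (x : {ffun 'I_d.+1 -> nat}) N j :
    (forall t, x t <= N)%N -> (coord d x j <= N)%N.
  by move=> xN; rewrite /coord; case: insub.
have coord_adj d (x y : {ffun 'I_d.+1 -> nat}) j :
    (forall t, x t <= (y t).+1 /\ y t <= (x t).+1)%N ->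
    (coord d x j <= (coord d y j).+1 /\ coord d y j <= (coord d x j).+1)%N.
  by move=> xy; rewrite /coord; case: insub.
have adjR (a b : nat) : (a <= b.+1 /\ b <= a.+1)%N -> `|a%:R - b%:R| <= 1 :> R.
  rewrite -(ler_nat R) -(ler_nat R b) -!natr1 => -[ab ba].
  by rewrite ler_norml; apply/andP; split; lra.
(* P (z, x) is the point L z + x, with z in the first m + 1 coordinates and the
   offset x in the first n + 1 coordinates, which may overlap *)
have /choice[P PE] : forall zx : {ffun 'I_m.+1 -> nat} * {ffun 'I_n.+1 -> nat},
    exists p : Xomega R k, val p = (i, truncate i (fun j =>
      L * (coord m zx.1 j)%:R + (coord n zx.2 j)%:R)).
  move=> [z x]; apply: Xomega_point; first by rewrite /i; lia.
  apply: (truncate_Xpart nk) => j nj; rewrite /= (coord0 n)// addr0; exact: multiplesM.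
have PdistE zx zx' j : (j < i)%N ->
    `|L * (coord m zx.1 j)%:R + (coord n zx.2 j)%:R -
      (L * (coord m zx'.1 j)%:R + (coord n zx'.2 j)%:R)| <= mdist (P zx) (P zx').
  move=> ji; rewrite Xomega_dist_same ?PE//=.
  by have := le_mdist (val (P zx)).2 (val (P zx')).2 j; rewrite !PE /= !truncateE ji.
have Pdist_le zx zx' d : 0 <= d -> (forall j,
    `|L * (coord m zx.1 j)%:R + (coord n zx.2 j)%:R -
      (L * (coord m zx'.1 j)%:R + (coord n zx'.2 j)%:R)| <= d) -> mdist (P zx) (P zx') <= d.
  move=> d0 H; rewrite Xomega_dist_same ?PE//=; apply: dmax_le => // j.
  by rewrite !truncateE; case: ifP => // _; rewrite subrr normr0.
(* each face has a point outside the families F *)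
have /choice[x xP] : forall z, exists x : {ffun 'I_n.+1 -> nat},
    (forall t, x t <= 2 ^ i)%N /\ forall j U, F j U -> ~ U (P (z, x)).
  move=> z; apply: (lebesgue_covering Fr) => [x y xM yM xy|x y j U xM yM x0 yM' FU Ux Uy].
    apply: Pdist_le => // j /=; rewrite opprD addrACA subrr add0r.
    exact/adjR/coord_adj.
  have := FD _ _ _ _ FU Ux Uy; apply/negP; rewrite -ltNge; apply: lt_le_trans pow_gt _.
  have ji : (j < i)%N by have := ltn_ord j; rewrite /i; lia.
  apply: le_trans (PdistE _ _ _ ji).
  by rewrite /= !coordE x0 yM' addr0 opprD addrA subrr add0r normrN ger0_norm.
have [D' GD] := uniformly_bounded_fin Gb.
have offset z j : 0 <= ((coord n (x z) j)%:R : R) <= L.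
  by rewrite ler0n -LE ler_nat; apply: coord_le; have [] := xP z.
(* the offsets shorten the distance between opposite faces by at most L, whence
   the summand 1 *)
pose M := (Num.bound `|D'|).+1.
have DM : D' < M%:R - 1.
  by rewrite /M -natr1 addrK (le_lt_trans (ler_norm _))// archi_boundP.
have [|z z' j U zM z'M z0 z'M' GU Uz Uz'|z [zM zG]] :=
  @lebesgue_covering _ _ m M _ G (fun z => P (z, x z)) Gr.
- move=> z z' zM z'M zz'; apply: Pdist_le => [|j /=]; first by lra.
  have := offset z j; have := offset z' j; have := adjR _ _ (coord_adj m _ _ j zz').
  set a := (coord m z j)%:R; set b := (coord m z' j)%:R.
  set u := (coord n _ j)%:R; set v := (coord n _ j)%:R.
  rewrite !ler_norml => /andP[ab ba] /andP[u0 u1] /andP[v0 v1].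
  by apply/andP; split; nra.
- have := GD _ _ _ _ GU Uz Uz'; apply/negP; rewrite -ltNge; apply: lt_le_trans DM _.
  have ji : (j < i)%N by have := ltn_ord j; rewrite /i; lia.
  apply: le_trans (PdistE _ _ _ ji); rewrite /= !coordE z0 z'M' mulr0 add0r.
  have := offset z j; have := offset z' j.
  set u := (coord n _ j)%:R; set v := (coord n _ j)%:R.
  move=> /andP[u0 u1] /andP[v0 v1]; rewrite distrC ler_normr; apply/orP; left.
  have M1 : 1 <= M%:R :> R by rewrite ler1n.
  by nra.
- by exists (P (z, x z)) => U; split=> j; [have [_] := xP z; apply|apply: zG].
Qed.

End lower_bound.

(** * The upper bound *)

Section line_cells.
Variables (R : realType) (s : R).

Definition near_grid (c x : R) : Prop := exists z : int, `|x - s * z%:~R| < c.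

(** Near a multiple of [s] a cell has to extend to both sides of it, because
    points of the same colour on the two sides may be close to each other. *)
Definition in_cell (c x : R) (a : bool * int) : Prop :=
  if a.1 then is_true (`|x - s * a.2%:~R| < c)
  else s * a.2%:~R <= x < s * (a.2 + 1)%:~R /\ ~ near_grid c x.

Lemma near_grid_le (c c' x : R) : c <= c' -> near_grid c x -> near_grid c' x.
Proof. by move=> cc [z xz]; exists z; exact: lt_le_trans cc. Qed.

Lemma multiples_near_grid (c x : R) : 0 < c -> multiples s x -> near_grid c x.
Proof. by move=> c0 [z _ <-]; exists z; rewrite subrr normr0. Qed.

Hypothesis s0 : 0 < s.

Lemma in_cell_ex (c x : R) : exists a, in_cell c x a.
Proof.
have [[z xz]|nx] := pselect (near_grid c x); first by exists (true, z).
exists (false, Num.floor (x / s)); split => //=.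
have /andP[] := mem_rg1_floor (x / s).
rewrite ler_pdivlMr// ltr_pdivrMr// => fx xf.
by rewrite mulrC fx mulrC intrD.
Qed.

Lemma int_mul_lt (z w : int) : s * z%:~R < s * w%:~R -> s * z%:~R + s <= s * w%:~R.
Proof.
rewrite ltr_pM2l// ltr_int => zw.
by rewrite -[X in _ + X]mulr1 -mulrDr ler_pM2l// -(intrD _ z 1) ler_int; lia.
Qed.

(** The cells of a fixed [c] touch each other, but they become [r]-separated once
    the points at distance between [c] and [c + g] from the grid are removed. *)
Lemma in_cell_eq (r c g x y : R) a b : 0 <= r -> r <= g -> c + c + r <= s -> 0 < c ->
  near_grid c x \/ ~ near_grid (c + g) x -> near_grid c y \/ ~ near_grid (c + g) y ->
  in_cell c x a -> in_cell c y b -> `|x - y| <= r -> a = b.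
Proof.
move=> r0 rg cs c0 gx gy.
wlog: x y a b gx gy / s * a.2%:~R <= s * b.2%:~R => [H|ab] xa yb xy.
  have [ab|/ltW ba] := leP (s * a.2%:~R) (s * b.2%:~R); first exact: (H x y).
  by rewrite distrC in xy; apply/esym; apply: (H y x).
have near_far u v : near_grid c u -> ~ near_grid (c + g) v -> `|u - v| <= r -> False.
  move=> [z uz] nv uv; apply: nv; exists z.
  by move: uz uv; rewrite !ltr_norml !ler_norml => /andP[? ?] /andP[? ?]; apply/andP; split; lra.
have sub z w : s * z%:~R <= s * w%:~R -> s * w%:~R < s * z%:~R + s -> z = w.
  move=> zw wz; apply/eqP; rewrite -(eqr_int R) -(inj_eq (mulfI (lt0r_neq0 s0))) eq_le zw /=.
  by rewrite leNgt; apply/negP => /int_mul_lt; rewrite leNgt wz.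
case: a b ab xa yb => [[] z] [[] w]; rewrite /in_cell /= => zw xz yw.
- congr pair; apply: sub zw _; move: xz yw xy.
  by rewrite !ltr_norml !ler_norml => /andP[? ?] /andP[? ?] /andP[? ?]; lra.
- have [_ ny] := yw; case: (near_far x y) => //; first by exists z.
  by case: gy.
- have [_ nx] := xz; rewrite distrC in xy; case: (near_far y x) => //; first by exists w.
  by case: gx.
- have [/andP[zx xz'] nx] := xz; have [/andP[wy yw'] ny] := yw.
  congr pair; apply: sub zw _; rewrite ltNge; apply/negP => zw.
  have {gy} [//|[]] := gy; exists w; rewrite intrD mulrDr mulr1 in xz'.
  by move: xy; rewrite ltr_norml ler_norml => /andP[? ?]; apply/andP; split; lra.
Qed.

Lemma in_cell_dist (c x y : R) a : c + c <= s ->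
  in_cell c x a -> in_cell c y a -> `|x - y| <= s.
Proof.
move=> cs; case: a => [[] z]; rewrite /in_cell /=.
  by rewrite !ltr_norml ler_norml => /andP[? ?] /andP[? ?]; apply/andP; split; lra.
rewrite intrD mulrDr mulr1 ler_norml => -[/andP[? ?] _] [/andP[? ?] _].
by apply/andP; split; lra.
Qed.

(** As [t] grows the thresholds [(k + 1 - t) g] decrease to [g], so the set of
    indices whose value is not near the grid grows, up to at most [k] elements
    for [t = k].  It cannot grow strictly at each of the [k + 1] steps from the
    empty set; where it does not grow, no value is in the gap. *)
Lemma gap_ex n (X : 'I_n -> R) (k : nat) (g : R) : 0 < g ->
  (#|[pred j | X j \notin multiples s]| <= k)%N ->
  exists t : 'I_k.+1, let c := (k.+1 - t)%:R * g in
    forall j, near_grid c (X j) \/ ~ near_grid (c + g) (X j).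
Proof.
move=> g0 Xk; pose c (t : nat) : R := (k.+1 - t)%:R * g.
pose bad t := [set j | ~~ `[< near_grid (c t) (X j) >]]%SET.
have badk : (#|bad k| <= k)%N.
  apply: leq_trans Xk; apply: subset_leq_card; apply/fintype.subsetP => j; rewrite !inE.
  apply: contra => /set_mem Xj; apply/asboolP; apply: multiples_near_grid Xj.
  by rewrite /c subSn// subnn mul1r.
have bad_ex : exists t, (#|bad t| <= t)%N by exists k.
case: (ex_minnP bad_ex) => t bt tmin; have tk := tmin _ badk.
have tk1 : (t < k.+1)%N by rewrite ltnS.
exists (Ordinal tk1) => /= j.
have [nj|nj] := pselect (near_grid ((k.+1 - t)%:R * g) (X j)); [by left|right].
have jt : j \in bad t by rewrite inE; apply/asboolPn.
case: t bt tmin tk tk1 nj jt => [|t] bt tmin tk tk1 nj jt.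
  by move: bt; rewrite leqn0 cards_eq0 => /eqP b0; rewrite b0 inE in jt.
have bt1 : (t < #|bad t|)%N by rewrite ltnNge; apply/negP => /tmin; rewrite ltnn.
have cS : c t.+1 + g = c t.
  by rewrite /c subSS subSn ?(ltnW tk)// -natr1 mulrDl mul1r.
have sub : bad t \subset bad t.+1.
  apply/fintype.subsetP => u; rewrite !inE; apply: contra => /asboolP H; apply/asboolP.
  by apply: near_grid_le H; rewrite -cS lerDl ltW.
have e : bad t = bad t.+1 by apply/eqP; rewrite eqEcard sub (leq_trans bt bt1).
by move: jt; rewrite -e inE -cS => /asboolPn.
Qed.

End line_cells.

(** The pieces are the classes of equal colour and key.  The margin between [r]
    and [r'] makes the infimum of the distances strictly larger than [r]. *)
Lemma families_of_colouring (R : realType) (X : metricType R) (A : set X) n (K : Type)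
    (col : X -> 'I_n.+1) (key : X -> K) (r r' D : R) : r < r' ->
  (forall p q, A p -> A q -> col p = col q -> mdist p q <= r' -> key p = key q) ->
  (forall p q, A p -> A q -> col p = col q -> key p = key q -> mdist p q <= D) ->
  exists F : 'I_n.+1 -> set (set X),
    [/\ forall i U, F i U -> U `<=` A, forall i, r_disjoint r (F i),
        forall i, uniformly_bounded (F i) & A `<=` \bigcup_i \bigcup_(U in F i) U].
Proof.
move=> rr near bnd; pose piece i a := [set p | [/\ A p, col p = i & key p = a]].
exists (fun i => range (piece i)); split.
- by move=> i _ [a _ <-] p [].
- move=> i _ _ [a _ <-] [b _ <-] ab; apply: (@lt_le_trans _ _ r'%:E); first by rewrite lte_fin.
  apply: le_ereal_inf_tmp => _ [p [Ap pi pa] [q [Aq qi qb] <-]]; rewrite lee_fin leNgt.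
  apply/negP => /ltW pq; apply: ab; congr piece.
  by rewrite -pa -qb; apply: near => //; rewrite pi qi.
- move=> i; apply/uniformly_boundedP; exists D => _ p q [a _ <-] [Ap pi pa] [Aq qi qa].
  by apply: bnd; rewrite ?pi ?qi ?pa ?qa.
- by move=> p Ap; exists (col p) => //; exists (piece (col p) (key p)) => //; exists (key p).
Qed.

Section upper_bound.
Variables (R : realType) (k : nat).
Local Notation seqR := {fsfun nat -> R with 0}.
Local Notation part p := (val p).1.
Local Notation coord p := ((val p).2 : seqR).

(** The map [tag] tells how far summands may be merged: separate summands have
    separate tags when they are far apart, and a single tag can be used when
    there are finitely many of them. *)
Lemma skeleton_families (A : set (Xomega R k)) (T : Type) (tag : Xomega R k -> T)
    (k' E : nat) (r s : R) : 0 < r -> ((4 * k'.+1)%:R + 1) * (r + 1) <= s ->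
  (forall p, A p -> (#|[pred j : 'I_(part p) | coord p j \notin multiples s]| <= k')%N) ->
  (forall p q, A p -> A q -> mdist p q <= r + 1 -> tag p = tag q) ->
  (forall p q, A p -> A q -> tag p = tag q ->
     (\sum_(minn (part p) (part q) <= j < maxn (part p) (part q)) j <= E)%N) ->
  exists F : 'I_k'.+1 -> set (set (Xomega R k)),
    [/\ forall i U, F i U -> U `<=` A, forall i, r_disjoint r (F i),
        forall i, uniformly_bounded (F i) & A `<=` \bigcup_i \bigcup_(U in F i) U].
Proof.
move=> r0 rs Ak tag1 tag2; pose g : R := 2 * (r + 1).
pose c (t : 'I_k'.+1) : R := (k'.+1 - t)%:R * g.
have g0 : 0 < g by rewrite /g; lra.
have c0 t : 0 < c t by rewrite mulr_gt0// ltr0n subn_gt0 ltn_ord.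
have cs t : c t + c t + (r + 1) <= s.
  apply: le_trans rs; rewrite mulrDl mul1r lerD2r natrM.
  have : ((k'.+1 - t)%:R : R) <= k'.+1%:R by rewrite ler_nat leq_subr.
  rewrite /c /g; set a := _%:R; set b := _%:R => ab; nra.
have s0 : 0 < s by have := cs ord0; have := c0 ord0; lra.
have /choice[col colP] : forall p, exists t, A p -> forall j,
    near_grid s (c t) (coord p j) \/ ~ near_grid s (c t + g) (coord p j).
  move=> p; have [Ap|?] := pselect (A p); last by exists ord0.
  have [t tP] := gap_ex g0 (Ak p Ap); exists t => _ j.
  have [ji|ij] := ltnP j (part p); first exact: (tP (Ordinal ji)).
  left; apply: multiples_near_grid => //; exists 0 => //; rewrite mulr0.
  by case/andP: (valP p) => _ /set_mem[-> //].
have /choice[cell cellP] : forall p, exists f : nat -> bool * int,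
    forall j, in_cell s (c (col p)) (coord p j) (f j).
  by move=> p; have /choice[f fP] := fun j => in_cell_ex s0 (c (col p)) (coord p j); exists f.
apply: (@families_of_colouring _ _ A k' _ col (fun p => (tag p, cell p)) r (r + 1) (s + E%:R)).
- lra.
- move=> p q Ap Aq pq d; congr pair; first exact: tag1.
  apply/funext => j; have cp := cellP p j; have cq := cellP q j.
  have gp := colP p Ap j; have gq := colP q Aq j; rewrite -pq in gq cq.
  apply: (in_cell_eq s0 _ _ (cs _) (c0 _) gp gq cp cq); [lra|rewrite /g; lra|].
  apply: le_trans d; rewrite Xomega_dist; apply: le_trans (le_mdist _ _ j) _.
  by rewrite lerDl.
- move=> p q Ap Aq pq [tpq cpq]; rewrite Xomega_dist lerD ?ler_nat ?tag2//.
  apply: dmax_le => [|j]; first exact: ltW.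
  have cp := cellP p j; have cq := cellP q j; rewrite -pq -cpq in cq.
  by apply: (in_cell_dist _ cp cq); have := cs (col p); lra.
Qed.

(** In the summands before [i0] there are fewer than [i0] coordinates, so their
    points lie in the [i0]-skeleton of every grid. *)
Lemma coasdim_finite_part (A : set (Xomega R k)) i0 :
  (forall p, A p -> part p < i0)%N -> coasdim_le A (Oaddn Ozero i0).
Proof.
move=> Ai; apply: (@CoasdimLe _ _ _ _ Ozero i0).
- by move=> [b [_ /(_ tt)[]]].
- by split; exact: ord_le_refl.
move=> r r0; have [|||F [FA Fr Fb AF]] :=
  @skeleton_families A unit (fun=> tt) i0 (i0 * i0) r _ r0 (lexx _).
- move=> p /Ai pi; apply: leq_trans (max_card _) _; rewrite card_ord; exact: ltnW.
- by [].
- move=> p q /Ai pi /Ai qi _; set a := minn _ _; set b := maxn _ _.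
  have bi : (b <= i0)%N by rewrite /b; lia.
  apply: (@leq_trans (\sum_(a <= j < b) i0)); last by rewrite sum_nat_const_nat leq_mul//; lia.
  by rewrite !big_nat; apply: leq_sum => j; lia.
by exists F; split => //; left; rewrite setD_eq0.
Qed.

Lemma coasdim_Xomega_le : coasdim_le [set: Xomega R k] (Oaddn Oomega k).
Proof.
apply: (@CoasdimLe _ _ _ _ Oomega k); first exact: Oomega_limit.
  by split; exact: ord_le_refl.
move=> r r0; set s0 := ((4 * k.+1)%:R + 1) * (r + 1).
have s00 : 0 <= s0 by rewrite mulr_ge0//; lra.
pose e := Num.bound s0; pose i0 := (e + Num.bound (r + 1))%N.
have s0e : s0 <= 2 ^+ e.
  rewrite -natrX; apply/ltW/(lt_trans (archi_boundP s00)).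
  by rewrite ltr_nat ltn_expl.
have ri0 : r + 1 < i0%:R.
  by rewrite (lt_le_trans (archi_boundP _))// ?ler_nat ?leq_addl//; lra.
pose A : set (Xomega R k) := [set p | (i0 <= part p)%N].
have [||| F [_ Fr Fb AF]] := @skeleton_families A nat (fun p => part p) k 0 r _ r0 s0e.
- move=> p Ap; have [_ /set_mem[_]] := andP (valP p).
  apply: leq_trans; apply: subset_leq_card; apply/fintype.subsetP => j; rewrite !inE.
  apply: contra => /set_mem[z _ zE]; apply/mem_set.
  exists (2 ^+ (part p - e) * z) => //; rewrite -zE intrM rmorphXn mulrA -exprD subnKC//.
  by apply: leq_trans Ap; rewrite leq_addr.
- move=> p q Ap Aq; rewrite Xomega_dist => d; apply/eqP; rewrite eqn_leq.
  have : (\sum_(minn (part p) (part q) <= j < maxn (part p) (part q)) j < i0)%N.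
    rewrite -(ltr_nat R); apply: le_lt_trans ri0; apply: le_trans d.
    by rewrite lerDr mdist_ge0.
  have pi : (i0 <= part p)%N := Ap; have qi : (i0 <= part q)%N := Aq.
  by case: (ltngtP (part p) (part q)) => // pq; rewrite big_ltn//; lia.
- by move=> p q _ _ ->; rewrite minnn maxnn big_geq.
exists F; split => //; right; exists (Oaddn Ozero i0); first exact: finite_lt_omega.
apply: coasdim_finite_part => p [_ pF]; rewrite ltnNge; apply/negP => Ap.
by apply: pF; apply: AF.
Qed.

(** Below [omega] the remainder is taken to be the whole space, left by empty
    families. *)
Lemma coasdim_Xomega_ge b : (0 < k)%N -> ord_lt b (Oaddn Oomega k) ->
  ~ coasdim_le [set: Xomega R k] b.
Proof.
move=> k0 bk Xb.
suff : exists n m (F : 'I_n.+1 -> set (set (Xomega R k))),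
    [/\ (n < k)%N, forall j, r_disjoint 1 (F j), forall j, uniformly_bounded (F j) &
    forall r : R, 0 < r -> exists G : 'I_m.+1 -> set (set (Xomega R k)),
      [/\ forall j, r_disjoint r (G j), forall j, uniformly_bounded (G j) &
      [set: Xomega R k] `\` \bigcup_i \bigcup_(U in F i) U `<=`
        \bigcup_i \bigcup_(U in G i) U]].
  move=> [n [m [F [nk Fr Fb FG]]]].
  have [r r0 H] := coasdim_lower m nk Fr Fb.
  have [G [Gr Gb FGT]] := FG r r0; have [p pP] := H G Gr Gb.
  have [|j _ [U GU Up]] := FGT p; last by have [_ /(_ j GU)] := pP U.
  by split => // -[j _ [U FU Up]]; have [/(_ j FU)] := pP U.
have [bo|ob] := ord_lt_total b Oomega.
  have [m H] := coasdim_lt_omega bo Xb.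
  exists 0%N, m, (fun=> set0); split => //.
  - by move=> j U V [].
  - by move=> j; apply/uniformly_boundedP; exists 0.
  move=> r r0; have [G [Gr Gb XG]] := H r r0; exists G; split => //.
  by move=> p _; exact: XG.
have [l [n [ll bE H]]] := coasdim_le_inv Xb.
have [nk lo] := decomposition_lt_omegaD ll bE bk ob.
have [F [_ Fr Fb [B0|[c cl Bc]]]] := H 1 ltr01.
  exists n, 0%N, F; split => // r r0; exists (fun=> set0); split; last by rewrite B0.
  - by move=> j U V [].
  - by move=> j; apply/uniformly_boundedP; exists 0.
have [m Hm] := coasdim_lt_omega (lo c cl) Bc.
by exists n, m, F; split.
Qed.

End upper_bound.

Theorem theorem3p2 (R : realType) (k : nat) (hk : (0 < k)%N) :
  coasdim_is [set: Xomega R k]%classic (Dord (Oaddn Oomega k)).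
Proof.
split; [|exact: coasdim_Xomega_le|by move=> b /(coasdim_Xomega_ge hk)].
have [|p _] := @Xomega_point R k 1 (truncate 1 (fun=> 0)) (ltnSn 0).
  by apply: (truncate_Xpart hk) => j _; exists 0 => //; rewrite mulr0.
by move/seteqP => [/(_ p I)].
Qed.
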